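(* Let $J$ be an IMV-algebra, $\mathcal C(J)$ its central MV-algebra, and $\mathcal I(\mathcal C(J))$ the IMV-algebra of all intervals of $\mathcal C(J)$. Then the map $\gamma_J\colon J\to\mathcal I(\mathcal C(J))$, $\gamma_J(x)=[\Delta x,\nabla x]$, is an isomorphism of $J$ onto $\mathcal I(\mathcal C(J))$.
   Context: An IMV-algebra is an algebra $J=(J,0,1,\iota,\neg,\Delta,\nabla,\oplus,\odot)$ of type $(0,0,0,1,1,1,2,2)$ satisfying the equations: $x\oplus(y\oplus z)=(x\oplus y)\oplus z$; $x\oplus y=y\oplus x$; $x\oplus 0=x$; $x\oplus\neg 0=\neg 0$; $\neg\neg x=x$; $\neg(\neg\Delta x\oplus\Delta y)\oplus\Delta y=\neg(\neg\Delta y\oplus\Delta x)\oplus\Delta x$; $x\odot y=\neg(\neg x\oplus\neg y)$; $1=\neg 0$; $\nabla x=\neg\Delta\neg x$; $\neg\iota=\iota$; $\Delta 0=0$; $\Delta 1=1$; $\Delta\iota=0$; $\Delta\Delta x=\Delta x$; $\Delta\nabla x=\nabla x$; $\Delta(x\oplus y)=\Delta x\oplus\Delta y$; $\Delta(x\odot y)=\Delta x\odot\Delta y$; $\Delta x\odot\neg\nabla x=0$; $\Delta x\oplus(\iota\odot\nabla x\odot\neg\Delta x)=x$. The center is $C(J)=\{x\in J\mid \Delta x=\nabla x\}$; it contains $0,1$ and is closed under $\neg,\oplus,\odot$, and $\mathcal C(J)=(C(J),0,1,\neg,\oplus,\odot)$ is an MV-algebra (the central MV-algebra of $J$). For an MV-algebra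 $A$ with natural order $\leq$, $\mathcal I(A)$ is the set of intervals $[\alpha,\beta]=\{\xi\mid\alpha\leq\xi\leq\beta\}$ ($\alpha\leq\beta$) with constants $0=[0,0]$, $1=[1,1]$, $\iota=A$, and operations $\neg x=\{\neg\alpha\mid\alpha\in x\}$, $x\oplus y=\{\alpha\oplus\beta\mid\alpha\in x,\beta\in y\}$, $x\odot y=\{\alpha\odot\beta\mid\alpha\in x,\beta\in y\}$ (these are intervals), $\Delta[\alpha,\beta]=[\alpha,\alpha]$, $\nabla[\alpha,\beta]=[\beta,\beta]$. *)

(* Defs.v *)
From mathcomp Require Import all_boot.
From mathcomp Require Import boolp classical_sets.

Set Implicit Arguments.
Unset Strict Implicit.
Unset Printing Implicit Defensive.

Reserved Notation "x ⊕ y" (at level 50, left associativity).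
Reserved Notation "x ⊙ y" (at level 40, left associativity).
Reserved Notation "¬ x" (at level 35, right associativity).
Reserved Notation "'Δ' x" (at level 35, right associativity).
Reserved Notation "∇ x" (at level 35, right associativity).
Reserved Notation "x ≼ y" (at level 70, no associativity).

Declare Scope mv_scope.
Delimit Scope mv_scope with MV.
Declare Scope imv_scope.
Delimit Scope imv_scope with IMV.

Local Open Scope classical_set_scope.

Record mvType := MVType {
  mv_sort :> Type;
  mv0 : mv_sort;
  mv1 : mv_sort;
  mv_neg : mv_sort -> mv_sort;
  mv_add : mv_sort -> mv_sort -> mv_sort;
  mv_mul : mv_sort -> mv_sort -> mv_sort;
  mv_addA : forall x y z, mv_add x (mv_add y z) = mv_add (mv_add x y) z;
  mv_addC : forall x y, mv_add x y = mv_add y x;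
  mv_addx0 : forall x, mv_add x mv0 = x;
  mv_addxN0 : forall x, mv_add x (mv_neg mv0) = mv_neg mv0;
  mv_negK : forall x, mv_neg (mv_neg x) = x;
  mv_luk : forall x y,
    mv_add (mv_neg (mv_add (mv_neg x) y)) y =
    mv_add (mv_neg (mv_add (mv_neg y) x)) x;
  mv_mulE : forall x y, mv_mul x y = mv_neg (mv_add (mv_neg x) (mv_neg y));
  mv_1E : mv1 = mv_neg mv0
}.

Arguments mv0 {_}.
Arguments mv1 {_}.
Notation "0" := mv0 : mv_scope.
Notation "1" := mv1 : mv_scope.
Notation "¬ x" := (mv_neg x) : mv_scope.
Notation "x ⊕ y" := (mv_add x y) : mv_scope.
Notation "x ⊙ y" := (mv_mul x y) : mv_scope.

Record imvType := IMVType {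
  imv_sort :> Type;
  imv0 : imv_sort;
  imv1 : imv_sort;
  imvi : imv_sort;
  imv_neg : imv_sort -> imv_sort;
  imv_low : imv_sort -> imv_sort;
  imv_upp : imv_sort -> imv_sort;
  imv_add : imv_sort -> imv_sort -> imv_sort;
  imv_mul : imv_sort -> imv_sort -> imv_sort;
  imv_addA : forall x y z, imv_add x (imv_add y z) = imv_add (imv_add x y) z;
  imv_addC : forall x y, imv_add x y = imv_add y x;
  imv_addx0 : forall x, imv_add x imv0 = x;
  imv_addxN0 : forall x, imv_add x (imv_neg imv0) = imv_neg imv0;
  imv_negK : forall x, imv_neg (imv_neg x) = x;
  imv_luk : forall x y,
    imv_add (imv_neg (imv_add (imv_neg (imv_low x)) (imv_low y))) (imv_low y) =
    imv_add (imv_neg (imv_add (imv_neg (imv_low y)) (imv_low x))) (imv_low x);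
  imv_mulE : forall x y,
    imv_mul x y = imv_neg (imv_add (imv_neg x) (imv_neg y));
  imv_1E : imv1 = imv_neg imv0;
  imv_uppE : forall x, imv_upp x = imv_neg (imv_low (imv_neg x));
  imv_negi : imv_neg imvi = imvi;
  imv_low0 : imv_low imv0 = imv0;
  imv_low1 : imv_low imv1 = imv1;
  imv_lowi : imv_low imvi = imv0;
  imv_low_low : forall x, imv_low (imv_low x) = imv_low x;
  imv_low_upp : forall x, imv_low (imv_upp x) = imv_upp x;
  imv_lowD : forall x y, imv_low (imv_add x y) = imv_add (imv_low x) (imv_low y);
  imv_lowM : forall x y, imv_low (imv_mul x y) = imv_mul (imv_low x) (imv_low y);
  imv_low_mulN_upp : forall x, imv_mul (imv_low x) (imv_neg (imv_upp x)) = imv0;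
  imv_decomp : forall x,
    imv_add (imv_low x)
      (imv_mul (imv_mul imvi (imv_upp x)) (imv_neg (imv_low x))) = x
}.

Arguments imv0 {_}.
Arguments imv1 {_}.
Arguments imvi {_}.
Notation "0" := imv0 : imv_scope.
Notation "1" := imv1 : imv_scope.
Notation "'ι'" := imvi : imv_scope.
Notation "¬ x" := (imv_neg x) : imv_scope.
Notation "'Δ' x" := (imv_low x) : imv_scope.
Notation "∇ x" := (imv_upp x) : imv_scope.
Notation "x ⊕ y" := (imv_add x y) : imv_scope.
Notation "x ⊙ y" := (imv_mul x y) : imv_scope.

Definition imv_morphism (J K : imvType) (f : J -> K) : Prop :=
  (f 0 = 0 /\ f 1 = 1 /\ f ι = ι /\
   (forall x, f (¬ x) = ¬ f x) /\
   (forall x, f (Δ x) = Δ f x) /\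
   (forall x, f (∇ x) = ∇ f x) /\
   (forall x y, f (x ⊕ y) = f x ⊕ f y) /\
   (forall x y, f (x ⊙ y) = f x ⊙ f y))%IMV.

Definition imv_isomorphism (J K : imvType) (f : J -> K) : Prop :=
  imv_morphism f /\ bijective f.

Definition mv_le (A : mvType) (x y : A) : Prop := (¬ x ⊕ y = 1)%MV.
Notation "x ≼ y" := (mv_le x y) : mv_scope.

Section MVTheory.
Variable A : mvType.
Implicit Types a b c d w x y z : A.
Local Open Scope mv_scope.

Lemma mv_N1 : ¬ 1 = 0 :> A.
Proof. by rewrite mv_1E mv_negK. Qed.

Lemma mv_addx1 x : x ⊕ 1 = 1.
Proof. by rewrite mv_1E mv_addxN0. Qed.

Lemma mv_add1x x : 1 ⊕ x = 1.
Proof. by rewrite mv_addC mv_addx1. Qed.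

Lemma mv_add0x x : 0 ⊕ x = x.
Proof. by rewrite mv_addC mv_addx0. Qed.

Lemma mv_addNx x : ¬ x ⊕ x = 1.
Proof. by have := mv_luk 1 x; rewrite mv_N1 mv_add0x !mv_addx1. Qed.

Lemma mv_negM x y : ¬ (x ⊙ y) = ¬ x ⊕ ¬ y.
Proof. by rewrite mv_mulE mv_negK. Qed.

Lemma mv_negD x y : ¬ (x ⊕ y) = ¬ x ⊙ ¬ y.
Proof. by rewrite mv_mulE !mv_negK. Qed.

Lemma mv_mulC x y : x ⊙ y = y ⊙ x.
Proof. by rewrite !mv_mulE mv_addC. Qed.

Lemma mv_mul1x x : 1 ⊙ x = x.
Proof. by rewrite mv_mulE mv_N1 mv_add0x mv_negK. Qed.

Lemma mv_mul0x x : 0 ⊙ x = 0.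
Proof. by rewrite mv_mulE -mv_1E mv_add1x mv_N1. Qed.

Lemma mv_le_refl x : x ≼ x.
Proof. exact: mv_addNx. Qed.

Lemma mv_le_anti x y : x ≼ y -> y ≼ x -> x = y.
Proof.
rewrite /mv_le => xy yx.
by have := mv_luk x y; rewrite xy yx mv_N1 !mv_add0x.
Qed.

Lemma mv_leDl x y : x ≼ x ⊕ y.
Proof. by rewrite /mv_le mv_addA mv_addNx mv_add1x. Qed.

Lemma mv_leDr x y : x ≼ y ⊕ x.
Proof. by rewrite mv_addC; exact: mv_leDl. Qed.

Lemma mv_le_subK x y : x ≼ y -> ¬ (¬ y ⊕ x) ⊕ x = y.
Proof. by move=> xy; rewrite -mv_luk xy mv_N1 mv_add0x. Qed.

Lemma mv_leD2r z x y : x ≼ y -> x ⊕ z ≼ y ⊕ z.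
Proof.
move=> /mv_le_subK <-; set t := mv_neg _.
by rewrite -mv_addA; exact: mv_leDr.
Qed.

Lemma mv_le_trans y x z : x ≼ y -> y ≼ z -> x ≼ z.
Proof.
move=> xy /mv_le_subK <-; move: xy => /mv_le_subK {2}<-.
by rewrite mv_addA; exact: mv_leDr.
Qed.

Lemma mv_leD x y z w : x ≼ y -> z ≼ w -> x ⊕ z ≼ y ⊕ w.
Proof.
move=> xy zw; apply: (@mv_le_trans (y ⊕ z)); first exact: mv_leD2r.
by rewrite ![y ⊕ _]mv_addC; exact: mv_leD2r.
Qed.

Lemma mv_leN x y : x ≼ y -> ¬ y ≼ ¬ x.
Proof. by rewrite /mv_le mv_negK mv_addC. Qed.

Lemma mv_leNl x y : ¬ x ≼ y -> ¬ y ≼ x.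
Proof. by move=> /mv_leN; rewrite mv_negK. Qed.

Lemma mv_leNr x y : x ≼ ¬ y -> y ≼ ¬ x.
Proof. by move=> /mv_leN; rewrite mv_negK. Qed.

Lemma mv_leM x y z w : x ≼ y -> z ≼ w -> x ⊙ z ≼ y ⊙ w.
Proof.
by move=> xy zw; rewrite !mv_mulE; apply/mv_leN/mv_leD; exact: mv_leN.
Qed.

Lemma mv_le0 x : 0 ≼ x.
Proof. by rewrite /mv_le -mv_1E mv_add1x. Qed.

Lemma mv_le1 x : x ≼ 1.
Proof. exact: mv_addx1. Qed.

Let sub x y := ¬ (¬ x ⊕ y).
Let join x y := sub x y ⊕ y.

Let sub_leP x y z : sub x y ≼ z <-> x ≼ y ⊕ z.
Proof. by rewrite /mv_le /sub mv_negK mv_addA. Qed.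

Let le_sub x y z : x ≼ y -> sub x z ≼ sub y z.
Proof. by move=> xy; apply/mv_leN/mv_leD2r/mv_leN. Qed.

Let joinC x y : join x y = join y x.
Proof. exact: mv_luk. Qed.

Let le_joinr x y : y ≼ join x y.
Proof. exact: mv_leDr. Qed.

Let le_joinl x y : x ≼ join x y.
Proof. by rewrite joinC; exact: le_joinr. Qed.

Let join_r x y : y ≼ x -> join x y = x.
Proof. exact: mv_le_subK. Qed.

Let join_le x y z : x ≼ z -> y ≼ z -> join x y ≼ z.
Proof.
move=> xz yz; rewrite -[X in _ ≼ X](join_r yz).
by apply: mv_leD2r; exact: le_sub.
Qed.

(* [¬ join (¬ x) (¬ y)] is the meet of x and y; it equals [x ⊙ (¬ x ⊕ y)] *)
Let meet x y := ¬ join (¬ x) (¬ y).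

Let meetE x y : meet x y = x ⊙ (¬ x ⊕ y).
Proof.
rewrite /meet joinC /join /sub mv_mulE mv_negK; congr mv_neg.
by rewrite mv_addC [¬ x ⊕ y]mv_addC.
Qed.

Let meetC x y : meet x y = meet y x.
Proof. by rewrite /meet joinC. Qed.

Let mul_leP x y z : x ⊙ y ≼ z <-> x ≼ ¬ y ⊕ z.
Proof. by rewrite /mv_le mv_negM mv_addA. Qed.

(* lattice distributivity, via the residuation of ⊙ *)
Let meet_join_le x y z w :
  meet x z ≼ w -> meet y z ≼ w -> meet (join x y) z ≼ w.
Proof.
rewrite !meetE => xw yw; apply/mul_leP/join_le; apply/mul_leP.
  apply: mv_le_trans xw; apply: mv_leM; first exact: mv_le_refl.
  by apply/mv_leD2r/mv_leN; exact: le_joinl.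
apply: mv_le_trans yw; apply: mv_leM; first exact: mv_le_refl.
by apply/mv_leD2r/mv_leN; exact: le_joinr.
Qed.

Let sub_addE x z : sub (x ⊕ z) z = meet x (¬ z).
Proof. by rewrite /sub /meet /join /sub !mv_negK. Qed.

Let join_add_le x y z w : x ⊕ z ≼ w -> y ⊕ z ≼ w -> join x y ⊕ z ≼ w.
Proof.
move=> xw yw.
have zw : z ≼ w by apply: mv_le_trans xw; exact: mv_leDr.
rewrite -[X in X ≼ _](join_r (mv_leDr z (join x y))) -(join_r zw).
apply: mv_leD2r; rewrite sub_addE.
by apply: meet_join_le; rewrite -sub_addE; exact: le_sub.
Qed.

Lemma mv_riesz_add a b c d x : a ≼ b -> c ≼ d -> a ⊕ c ≼ x -> x ≼ b ⊕ d ->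
  exists u v, [/\ a ≼ u, u ≼ b, c ≼ v, v ≼ d & u ⊕ v = x].
Proof.
move=> ab cd acx xbd.
have cx : c ≼ x by apply: mv_le_trans acx; exact: mv_leDr.
pose u := join a (sub x d); pose v := join c (sub x u).
have ucx : u ⊕ c ≼ x.
  apply: join_add_le => //; rewrite -[X in _ ≼ X](join_r cx).
  by apply: mv_leD2r; apply/mv_leN/mv_leD => //; exact: mv_le_refl.
have ux : u ≼ x by apply: mv_le_trans ucx; exact: mv_leDl.
exists u, v; split.
- exact: le_joinl.
- by apply: join_le => //; apply/sub_leP; rewrite mv_addC.
- exact: le_joinl.
- by apply: join_le => //; apply/sub_leP; rewrite mv_addC; apply/sub_leP/le_joinr.
- apply: mv_le_anti.
    rewrite mv_addC; apply: join_add_le; first by rewrite mv_addC.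
    by rewrite -[X in _ ≼ X](join_r ux); exact: mv_le_refl.
  by apply/sub_leP; exact: le_joinr.
Qed.

Lemma mv_riesz_mul a b c d x : a ≼ b -> c ≼ d -> a ⊙ c ≼ x -> x ≼ b ⊙ d ->
  exists u v, [/\ a ≼ u, u ≼ b, c ≼ v, v ≼ d & u ⊙ v = x].
Proof.
move=> ab cd acx xbd.
have [||||u [v [bu ua dv vc uv]]] := @mv_riesz_add (¬ b) (¬ a) (¬ d) (¬ c) (¬ x).
- exact: mv_leN.
- exact: mv_leN.
- by rewrite -mv_negM; exact: mv_leN.
- by rewrite -mv_negM; exact: mv_leN.
exists (¬ u), (¬ v); split; [exact: mv_leNr|exact: mv_leNl|exact: mv_leNr
  |exact: mv_leNl|by rewrite -mv_negD uv mv_negK].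
Qed.

End MVTheory.

Section Intervals.
Variable A : mvType.
Implicit Types a b c d : A.
Local Open Scope mv_scope.

Definition mv_segment a b : set A := [set x | a ≼ x /\ x ≼ b].

Record mv_interval := MVInterval {
  mv_interval_set :> set A;
  mv_intervalP : exists a b, a ≼ b /\ mv_interval_set = mv_segment a b
}.

Implicit Types X Y : mv_interval.

Lemma mv_interval_eq X Y : (X : set A) = Y -> X = Y.
Proof.
case: X Y => [X HX] [Y HY] /= XY; case: _ / XY HY => HY.
by congr MVInterval.
Qed.

Fact mv_itv_subproof a b (ab : a ≼ b) :
  exists a' b', a' ≼ b' /\ mv_segment a b = mv_segment a' b'.
Proof. by exists a, b. Qed.

Definition mv_itv a b (ab : a ≼ b) : mv_interval :=
  MVInterval (mv_itv_subproof ab).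

Lemma mv_itvE X : exists a b (ab : a ≼ b), X = mv_itv ab.
Proof.
by have [a [b [ab XE]]] := mv_intervalP X; exists a, b, ab; exact: mv_interval_eq.
Qed.

Lemma mv_itv_inj a b (ab : a ≼ b) c d (cd : c ≼ d) :
  mv_segment a b = mv_segment c d -> a = c /\ b = d.
Proof.
move=> E.
have [ca _] : mv_segment c d a by rewrite -E; split => //; exact: mv_le_refl.
have [_ bd] : mv_segment c d b by rewrite -E; split => //; exact: mv_le_refl.
have [ac _] : mv_segment a b c by rewrite E; split => //; exact: mv_le_refl.
have [_ db] : mv_segment a b d by rewrite E; split => //; exact: mv_le_refl.
by split; exact: mv_le_anti.
Qed.

Lemma mv_itv_congr a b (ab : a ≼ b) c d (cd : c ≼ d) :
  a = c -> b = d -> mv_itv ab = mv_itv cd.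
Proof. by move=> ac bd; apply: mv_interval_eq; rewrite /= ac bd. Qed.

(* The endpoints of an interval, uniquely determined by it: see [mv_linfE] and
   [mv_usupE] *)
Definition mv_linf X : A := projT1 (cid (mv_intervalP X)).
Definition mv_usup X : A := projT1 (cid (projT2 (cid (mv_intervalP X)))).

Lemma mv_linfE a b (ab : a ≼ b) : mv_linf (mv_itv ab) = a.
Proof.
rewrite /mv_linf; case: cid => /= c [d [cd E]].
by have [] := mv_itv_inj ab cd E.
Qed.

Lemma mv_usupE a b (ab : a ≼ b) : mv_usup (mv_itv ab) = b.
Proof.
rewrite /mv_usup; case: cid => /= c Hc; case: cid => /= d [cd E].
by have [] := mv_itv_inj ab cd E.
Qed.

Lemma mv_setN_segment a b :
  [set ¬ x | x in mv_segment a b] = mv_segment (¬ b) (¬ a).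
Proof.
apply/seteqP; split=> [_ [x [ax xb] <-]|y [by_ ya]]; first by split; exact: mv_leN.
exists (¬ y); last exact: mv_negK.
by split; [exact: mv_leNr|exact: mv_leNl].
Qed.

Lemma mv_setD_segment a b c d : a ≼ b -> c ≼ d ->
  [set x ⊕ y | x in mv_segment a b & y in mv_segment c d] =
  mv_segment (a ⊕ c) (b ⊕ d).
Proof.
move=> ab cd; apply/seteqP; split=> [_ [x [ax xb] [y [cy yd] <-]]|z [z1 z2]].
  by split; exact: mv_leD.
by have [u [v [? ? ? ? ?]]] := mv_riesz_add ab cd z1 z2; exists u => //; exists v.
Qed.

Lemma mv_setM_segment a b c d : a ≼ b -> c ≼ d ->
  [set x ⊙ y | x in mv_segment a b & y in mv_segment c d] =
  mv_segment (a ⊙ c) (b ⊙ d).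
Proof.
move=> ab cd; apply/seteqP; split=> [_ [x [ax xb] [y [cy yd] <-]]|z [z1 z2]].
  by split; exact: mv_leM.
by have [u [v [? ? ? ? ?]]] := mv_riesz_mul ab cd z1 z2; exists u => //; exists v.
Qed.

Fact mv_itvi_subproof : exists a b, a ≼ b /\ [set: A] = mv_segment a b.
Proof.
exists 0, 1; split; first exact: mv_le0.
by apply/seteqP; split=> // x _; split; [exact: mv_le0|exact: mv_le1].
Qed.

Fact mv_itvN_subproof X : exists a b, a ≼ b /\ [set ¬ x | x in X] = mv_segment a b.
Proof.
have [a [b [ab ->]]] := mv_intervalP X; exists (¬ b), (¬ a).
by split; [exact: mv_leN|exact: mv_setN_segment].
Qed.

Fact mv_itvD_subproof X Y :
  exists a b, a ≼ b /\ [set x ⊕ y | x in X & y in Y] = mv_segment a b.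
Proof.
have [a [b [ab ->]]] := mv_intervalP X; have [c [d [cd ->]]] := mv_intervalP Y.
by exists (a ⊕ c), (b ⊕ d); split; [exact: mv_leD|exact: mv_setD_segment].
Qed.

Fact mv_itvM_subproof X Y :
  exists a b, a ≼ b /\ [set x ⊙ y | x in X & y in Y] = mv_segment a b.
Proof.
have [a [b [ab ->]]] := mv_intervalP X; have [c [d [cd ->]]] := mv_intervalP Y.
by exists (a ⊙ c), (b ⊙ d); split; [exact: mv_leM|exact: mv_setM_segment].
Qed.

Definition mv_itv_pt a : mv_interval := mv_itv (mv_le_refl a).
Definition mv_itvi : mv_interval := MVInterval mv_itvi_subproof.
Definition mv_itvN X : mv_interval := MVInterval (mv_itvN_subproof X).
Definition mv_itvD X Y : mv_interval := MVInterval (mv_itvD_subproof X Y).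
Definition mv_itvM X Y : mv_interval := MVInterval (mv_itvM_subproof X Y).
Definition mv_itv_low X : mv_interval := mv_itv_pt (mv_linf X).
Definition mv_itv_upp X : mv_interval := mv_itv_pt (mv_usup X).

Lemma mv_itviE : mv_itvi = mv_itv (mv_le0 (1 : A)).
Proof.
apply: mv_interval_eq; apply/seteqP; split=> // x _.
by split; [exact: mv_le0|exact: mv_le1].
Qed.

Lemma mv_itvNE a b (ab : a ≼ b) : mv_itvN (mv_itv ab) = mv_itv (mv_leN ab).
Proof. by apply: mv_interval_eq; exact: mv_setN_segment. Qed.

Lemma mv_itvDE a b (ab : a ≼ b) c d (cd : c ≼ d) :
  mv_itvD (mv_itv ab) (mv_itv cd) = mv_itv (mv_leD ab cd).
Proof. by apply: mv_interval_eq; exact: mv_setD_segment. Qed.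

Lemma mv_itvME a b (ab : a ≼ b) c d (cd : c ≼ d) :
  mv_itvM (mv_itv ab) (mv_itv cd) = mv_itv (mv_leM ab cd).
Proof. by apply: mv_interval_eq; exact: mv_setM_segment. Qed.

Lemma mv_itv_lowE a b (ab : a ≼ b) : mv_itv_low (mv_itv ab) = mv_itv_pt a.
Proof. by rewrite /mv_itv_low mv_linfE. Qed.

Lemma mv_itv_uppE a b (ab : a ≼ b) : mv_itv_upp (mv_itv ab) = mv_itv_pt b.
Proof. by rewrite /mv_itv_upp mv_usupE. Qed.

Let E := (mv_itviE, mv_itv_lowE, mv_itv_uppE, mv_itvNE, mv_itvDE, mv_itvME).

Fact mv_itv_addA X Y Z : mv_itvD X (mv_itvD Y Z) = mv_itvD (mv_itvD X Y) Z.
Proof.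
have [a [b [ab ->]]] := mv_itvE X; have [c [d [cd ->]]] := mv_itvE Y.
have [e [f [ef ->]]] := mv_itvE Z.
by rewrite !E; apply: mv_itv_congr; exact: mv_addA.
Qed.

Fact mv_itv_addC X Y : mv_itvD X Y = mv_itvD Y X.
Proof.
have [a [b [ab ->]]] := mv_itvE X; have [c [d [cd ->]]] := mv_itvE Y.
by rewrite !E; apply: mv_itv_congr; exact: mv_addC.
Qed.

Fact mv_itv_addx0 X : mv_itvD X (mv_itv_pt 0) = X.
Proof.
have [a [b [ab ->]]] := mv_itvE X.
by rewrite !E; apply: mv_itv_congr; exact: mv_addx0.
Qed.

Fact mv_itv_addxN0 X :
  mv_itvD X (mv_itvN (mv_itv_pt 0)) = mv_itvN (mv_itv_pt 0).
Proof.
have [a [b [ab ->]]] := mv_itvE X.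
by rewrite !E; apply: mv_itv_congr; exact: mv_addxN0.
Qed.

Fact mv_itv_negK X : mv_itvN (mv_itvN X) = X.
Proof.
have [a [b [ab ->]]] := mv_itvE X.
by rewrite !E; apply: mv_itv_congr; exact: mv_negK.
Qed.

Fact mv_itv_luk X Y :
  mv_itvD (mv_itvN (mv_itvD (mv_itvN (mv_itv_low X)) (mv_itv_low Y)))
    (mv_itv_low Y) =
  mv_itvD (mv_itvN (mv_itvD (mv_itvN (mv_itv_low Y)) (mv_itv_low X)))
    (mv_itv_low X).
Proof. by rewrite !E; apply: mv_itv_congr; exact: mv_luk. Qed.

Fact mv_itv_mulE X Y : mv_itvM X Y = mv_itvN (mv_itvD (mv_itvN X) (mv_itvN Y)).
Proof.
have [a [b [ab ->]]] := mv_itvE X; have [c [d [cd ->]]] := mv_itvE Y.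
by rewrite !E; apply: mv_itv_congr; exact: mv_mulE.
Qed.

Fact mv_itv_1E : mv_itv_pt 1 = mv_itvN (mv_itv_pt 0).
Proof. by rewrite !E; apply: mv_itv_congr; exact: mv_1E. Qed.

Fact mv_itv_upp_lowE X : mv_itv_upp X = mv_itvN (mv_itv_low (mv_itvN X)).
Proof.
have [a [b [ab ->]]] := mv_itvE X.
by rewrite !E; apply: mv_itv_congr; rewrite mv_negK.
Qed.

Fact mv_itv_negi : mv_itvN mv_itvi = mv_itvi.
Proof.
by rewrite !E; apply: mv_itv_congr; [exact: mv_N1|rewrite mv_1E].
Qed.

Fact mv_itv_low_pt a : mv_itv_low (mv_itv_pt a) = mv_itv_pt a.
Proof. by rewrite !E. Qed.

Fact mv_itv_lowi : mv_itv_low mv_itvi = mv_itv_pt 0.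
Proof. by rewrite !E. Qed.

Fact mv_itv_lowD X Y :
  mv_itv_low (mv_itvD X Y) = mv_itvD (mv_itv_low X) (mv_itv_low Y).
Proof.
have [a [b [ab ->]]] := mv_itvE X; have [c [d [cd ->]]] := mv_itvE Y.
by rewrite !E; apply: mv_itv_congr.
Qed.

Fact mv_itv_lowM X Y :
  mv_itv_low (mv_itvM X Y) = mv_itvM (mv_itv_low X) (mv_itv_low Y).
Proof.
have [a [b [ab ->]]] := mv_itvE X; have [c [d [cd ->]]] := mv_itvE Y.
by rewrite !E; apply: mv_itv_congr.
Qed.

Fact mv_itv_low_mulN_upp X :
  mv_itvM (mv_itv_low X) (mv_itvN (mv_itv_upp X)) = mv_itv_pt 0.
Proof.
have [a [b [ab ->]]] := mv_itvE X; rewrite !E.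
by apply: mv_itv_congr; rewrite mv_mulE mv_negK ab mv_N1.
Qed.

Fact mv_itv_decomp X :
  mv_itvD (mv_itv_low X)
    (mv_itvM (mv_itvM mv_itvi (mv_itv_upp X)) (mv_itvN (mv_itv_low X))) = X.
Proof.
have [a [b [ab ->]]] := mv_itvE X; rewrite !E; apply: mv_itv_congr.
  by rewrite !mv_mul0x mv_addx0.
by rewrite mv_mul1x mv_mulE mv_negK mv_addC mv_le_subK.
Qed.

Definition imv_intervals : imvType :=
  IMVType mv_itv_addA mv_itv_addC mv_itv_addx0 mv_itv_addxN0 mv_itv_negK
    mv_itv_luk mv_itv_mulE mv_itv_1E mv_itv_upp_lowE mv_itv_negi
    (mv_itv_low_pt 0) (mv_itv_low_pt 1) mv_itv_lowi
    (fun X => mv_itv_low_pt (mv_linf X)) (fun X => mv_itv_low_pt (mv_usup X))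
    mv_itv_lowD mv_itv_lowM mv_itv_low_mulN_upp mv_itv_decomp.

End Intervals.

Section Center.
Variable J : imvType.
Implicit Types x y z : J.
Local Open Scope imv_scope.

Definition imv_center : Type := {x : J | Δ x = ∇ x}.

Implicit Types u v w : imv_center.

Lemma imv_center_eq u v : sval u = sval v -> u = v.
Proof. by case: u v => x hx [y hy] /= xy; exact: eq_exist. Qed.

Lemma imv_lowN x : Δ ¬ x = ¬ ∇ x.
Proof. by rewrite imv_uppE imv_negK. Qed.

Lemma imv_uppN x : ∇ ¬ x = ¬ Δ x.
Proof. by rewrite imv_uppE imv_negK. Qed.

Lemma imv_negM x y : ¬ (x ⊙ y) = ¬ x ⊕ ¬ y.
Proof. by rewrite imv_mulE imv_negK. Qed.

Lemma imv_negD x y : ¬ (x ⊕ y) = ¬ x ⊙ ¬ y.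
Proof. by rewrite imv_mulE !imv_negK. Qed.

Lemma imv_uppD x y : ∇ (x ⊕ y) = ∇ x ⊕ ∇ y.
Proof. by rewrite !imv_uppE imv_negD imv_lowM imv_negM. Qed.

Lemma imv_uppM x y : ∇ (x ⊙ y) = ∇ x ⊙ ∇ y.
Proof. by rewrite !imv_uppE imv_negM imv_lowD imv_negD. Qed.

Lemma imv_upp_upp x : ∇ ∇ x = ∇ x.
Proof. by rewrite [∇ x]imv_uppE imv_uppN imv_low_low. Qed.

Lemma imv_upp_low x : ∇ Δ x = Δ x.
Proof. by rewrite imv_uppE -[¬ Δ x]imv_uppN imv_low_upp imv_uppN imv_negK. Qed.

Lemma imv_center_fix x : Δ x = ∇ x -> Δ x = x.
Proof.
move=> xC; rewrite -[RHS]imv_decomp -xC imv_mulE [_ ⊙ Δ x]imv_mulE !imv_negK.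
rewrite -imv_addA [¬ Δ x ⊕ _]imv_addC.
have -> : Δ x ⊕ ¬ Δ x = 1.
  rewrite -[LHS]imv_negK imv_negD imv_negK imv_1E; congr imv_neg.
  by rewrite -[RHS](imv_low_mulN_upp x) -xC !imv_mulE imv_addC.
by rewrite imv_1E imv_addxN0 imv_negK imv_addx0.
Qed.

Fact imv_center0_subproof : Δ 0 = ∇ 0 :> J.
Proof.
by rewrite imv_uppE -imv_1E imv_low1 imv_low0 imv_1E imv_negK.
Qed.

Fact imv_center1_subproof : Δ 1 = ∇ 1 :> J.
Proof.
by rewrite imv_uppE imv_low1 imv_1E imv_negK imv_low0.
Qed.

Fact imv_centerN_subproof u : Δ ¬ sval u = ∇ ¬ sval u.
Proof. by rewrite imv_lowN imv_uppN (svalP u). Qed.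

Fact imv_centerD_subproof u v : Δ (sval u ⊕ sval v) = ∇ (sval u ⊕ sval v).
Proof. by rewrite imv_lowD imv_uppD (svalP u) (svalP v). Qed.

Fact imv_centerM_subproof u v : Δ (sval u ⊙ sval v) = ∇ (sval u ⊙ sval v).
Proof. by rewrite imv_lowM imv_uppM (svalP u) (svalP v). Qed.

Definition imv_center0 : imv_center := exist _ 0 imv_center0_subproof.
Definition imv_center1 : imv_center := exist _ 1 imv_center1_subproof.
Definition imv_centerN u : imv_center := exist _ (¬ sval u) (imv_centerN_subproof u).
Definition imv_centerD u v : imv_center :=
  exist _ (sval u ⊕ sval v) (imv_centerD_subproof u v).
Definition imv_centerM u v : imv_center :=
  exist _ (sval u ⊙ sval v) (imv_centerM_subproof u v).

Fact imv_center_addA u v w :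
  imv_centerD u (imv_centerD v w) = imv_centerD (imv_centerD u v) w.
Proof. by apply: imv_center_eq; exact: imv_addA. Qed.

Fact imv_center_addC u v : imv_centerD u v = imv_centerD v u.
Proof. by apply: imv_center_eq; exact: imv_addC. Qed.

Fact imv_center_addx0 u : imv_centerD u imv_center0 = u.
Proof. by apply: imv_center_eq; exact: imv_addx0. Qed.

Fact imv_center_addxN0 u :
  imv_centerD u (imv_centerN imv_center0) = imv_centerN imv_center0.
Proof. by apply: imv_center_eq; exact: imv_addxN0. Qed.

Fact imv_center_negK u : imv_centerN (imv_centerN u) = u.
Proof. by apply: imv_center_eq; exact: imv_negK. Qed.

Fact imv_center_luk u v :
  imv_centerD (imv_centerN (imv_centerD (imv_centerN u) v)) v =
  imv_centerD (imv_centerN (imv_centerD (imv_centerN v) u)) u.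
Proof.
apply: imv_center_eq => /=.
rewrite -(imv_center_fix (svalP u)) -(imv_center_fix (svalP v)).
exact: imv_luk.
Qed.

Fact imv_center_mulE u v :
  imv_centerM u v = imv_centerN (imv_centerD (imv_centerN u) (imv_centerN v)).
Proof. by apply: imv_center_eq; exact: imv_mulE. Qed.

Fact imv_center_1E : imv_center1 = imv_centerN imv_center0.
Proof. by apply: imv_center_eq; exact: imv_1E. Qed.

Definition central_mv : mvType :=
  MVType imv_center_addA imv_center_addC imv_center_addx0 imv_center_addxN0
    imv_center_negK imv_center_luk imv_center_mulE imv_center_1E.

Fact imv_lowC_subproof x : Δ Δ x = ∇ Δ x.
Proof. by rewrite imv_low_low imv_upp_low. Qed.

Fact imv_uppC_subproof x : Δ ∇ x = ∇ ∇ x.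
Proof. by rewrite imv_low_upp imv_upp_upp. Qed.

Definition imv_lowC x : central_mv := exist _ (Δ x) (imv_lowC_subproof x).
Definition imv_uppC x : central_mv := exist _ (∇ x) (imv_uppC_subproof x).

Fact imv_lowC_le_uppC x : (imv_lowC x ≼ imv_uppC x)%MV.
Proof.
apply: imv_center_eq => /=.
rewrite -[LHS]imv_negK imv_negD imv_negK imv_low_mulN_upp.
by rewrite imv_1E.
Qed.

Definition imv_gamma x : imv_intervals central_mv := mv_itv (imv_lowC_le_uppC x).

End Center.

(* Main.v *)
From mathcomp Require Import all_boot.
Require Import Defs.

(** The inverse of γ_J sends the interval [a, b] to a ⊕ (ι ⊙ b ⊙ ¬ a). The
    decomposition axiom makes it a left inverse. It is a right inverse because
    Δ ι = 0 and ∇ ι = 1, so that Δ and ∇ map this element to a and to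
    a ⊕ (b ⊙ ¬ a), which is b when a ≤ b. *)

Set Implicit Arguments.
Unset Strict Implicit.
Unset Printing Implicit Defensive.

Local Open Scope imv_scope.

Lemma imv_uppi (J : imvType) : ∇ ι = 1 :> J.
Proof. by rewrite imv_uppE imv_negi imv_lowi imv_1E. Qed.

(** The operations of [imv_intervals] act endpointwise, so each clause splits into one identity for
    [Δ] (lower endpoint) and one for [∇] (upper endpoint). *)
Lemma imv_gamma_morphism (J : imvType) : imv_morphism (@imv_gamma J).
Proof.
do ![split].
- by apply: mv_itv_congr; apply: imv_center_eq; rewrite /= ?imv_low0 //
    -imv_center0_subproof imv_low0.
- by apply: mv_itv_congr; apply: imv_center_eq; rewrite /= ?imv_low1 //
    -imv_center1_subproof imv_low1.
(* In the interval algebra [ι] is the whole center as a set; only when rewritten as the segment from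
   0 to 1 can its endpoints be compared. *)
- rewrite [RHS]mv_itviE; apply: mv_itv_congr; apply: imv_center_eq => /=.
    exact: imv_lowi.
  exact: imv_uppi.
- move=> x; rewrite [RHS]mv_itvNE; apply: mv_itv_congr; apply: imv_center_eq => /=.
    exact: imv_lowN.
  exact: imv_uppN.
- move=> x; rewrite [RHS]mv_itv_lowE; apply: mv_itv_congr; apply: imv_center_eq => /=.
    exact: imv_low_low.
  exact: imv_upp_low.
- move=> x; rewrite [RHS]mv_itv_uppE; apply: mv_itv_congr; apply: imv_center_eq => /=.
    exact: imv_low_upp.
  exact: imv_upp_upp.
- move=> x y; rewrite [RHS]mv_itvDE; apply: mv_itv_congr; apply: imv_center_eq => /=.
    exact: imv_lowD.
  exact: imv_uppD.
- move=> x y; rewrite [RHS]mv_itvME; apply: mv_itv_congr; apply: imv_center_eq => /=.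
    exact: imv_lowM.
  exact: imv_uppM.
Qed.

(** The left side of [imv_decomp] with [Δ x] and [∇ x] replaced by independent [a] and [b]. *)
Definition imv_glue (J : imvType) (a b : J) : J := a ⊕ (ι ⊙ b ⊙ ¬ a).

Lemma imv_center_low (J : imvType) (a : central_mv J) : Δ sval a = sval a.
Proof. exact: imv_center_fix (svalP a). Qed.

Lemma imv_center_upp (J : imvType) (a : central_mv J) : ∇ sval a = sval a.
Proof. by rewrite -(svalP a) imv_center_low. Qed.

Lemma imv_lowC_glue (J : imvType) (a b : central_mv J) :
  imv_lowC (imv_glue (sval a) (sval b)) = a.
Proof.
(* The middle term lives in [central_mv J], where the MV laws apply; its 0 stands for [Δ ι]. *)
transitivity (a ⊕ (0 ⊙ b ⊙ ¬ a))%MV; last by rewrite !mv_mul0x mv_addx0.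
apply: imv_center_eq; rewrite /= /imv_glue imv_lowD !imv_lowM imv_lowi.
by rewrite imv_lowN imv_center_upp !imv_center_low.
Qed.

Lemma imv_uppC_glue (J : imvType) (a b : central_mv J) : (a ≼ b)%MV ->
  imv_uppC (imv_glue (sval a) (sval b)) = b.
Proof.
(* Here 1 stands for [∇ ι]. What remains, [a ⊕ (b ⊙ ¬ a)], is the join of [a] and [b], hence [b] by
   [ab]. *)
move=> ab; transitivity (a ⊕ (1 ⊙ b ⊙ ¬ a))%MV; last first.
  by rewrite mv_mul1x mv_mulE mv_negK mv_addC mv_le_subK.
apply: imv_center_eq; rewrite /= /imv_glue imv_uppD !imv_uppM imv_uppi.
by rewrite imv_uppN imv_center_low !imv_center_upp.
Qed.

Theorem theorem3p4 (J : imvType) : imv_isomorphism (@imv_gamma J).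
Proof.
split; first exact: imv_gamma_morphism.
exists (fun X : imv_intervals (central_mv J) =>
  imv_glue (sval (mv_linf X)) (sval (mv_usup X))) => [x|X].
  by rewrite mv_linfE mv_usupE; exact: imv_decomp.
have [a [b [ab ->]]] := mv_itvE X; rewrite mv_linfE mv_usupE.
by apply: mv_itv_congr; [exact: imv_lowC_glue|exact: imv_uppC_glue].
Qed.
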